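(* Let $\mathcal{J}=\{J_t\}_{t\ge0}$ be a càdlàg jump process with finite state space $\mathcal{E}$ and finitely many jumps on compact intervals, let $\mathcal{F}^\lambda=\{F^\lambda_t\}_{t\ge0}$ be a process with continuous paths of finite variation on compact intervals, and let $x_0\in\mathbb{R}$. Assume that for every $i\in\mathcal{E}$: $\mu_i:\mathbb{R}_+\times\mathbb{R}\to\mathbb{R}$ is continuous, linearly growing and locally Lipschitz continuous; $\sigma_i:\mathbb{R}_+\times\mathbb{R}\to\mathbb{R}$ is in $\mathcal{C}^{1,1}$, linearly growing, locally Lipschitz continuous and Lipschitz continuous on its second entry; and $\partial_1\sigma_i$, $\partial_2\sigma_i$ are locally Lipschitz continuous. Then there is a unique continuous process $\mathcal{X}^\lambda=\{X^\lambda_t\}_{t\ge0}$ solving $$\mathrm{d}X^\lambda_t=\left(\mu_{J_t}(t,X^\lambda_t)-\tfrac12\sigma_{J_t}(t,X^\lambda_t)\,\partial_2\sigma_{J_t}(t,X^\lambda_t)\right)\mathrm{d}t+\sigma_{J_t}(t,X^\lambda_t)\,\mathrm{d}F^\lambda_t,\qquad X^\lambda_0=x_0.$$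
   Context: $\mathbb{R}_+=[0,\infty)$; $\partial_k$ is the partial derivative with respect to the $k$th entry. The equation is understood pathwise in integral form with Lebesgue–Stieltjes integrals. $\mathcal{C}^{1,1}$ is the class of continuous functions with continuous first partial derivatives in each of the two entries. A function $g:\mathbb{R}_+\times\mathbb{R}\to\mathbb{R}$ is: *linearly growing* if there is $E>0$ with $|g(t,x)|\le E(1+t+|x|)$ for all $t\ge0,x\in\mathbb{R}$; *locally Lipschitz continuous* if for each compact $\mathcal{K}\subset\mathbb{R}_+\times\mathbb{R}$ there is $M_{\mathcal{K}}>0$ with $|g(t_1,x_1)-g(t_2,x_2)|\le M_{\mathcal{K}}(|t_1-t_2|+|x_1-x_2|)$ for all $(t_1,x_1),(t_2,x_2)\in\mathcal{K}$; *Lipschitz continuous on its second entry* if there is $M>0$ with $|g(t,x_1)-g(t,x_2)|\le M|x_1-x_2|$ for all $t\ge0$, $x_1,x_2\in\mathbb{R}$. *)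

(* Defs.v *)
From HB Require Import structures.
From mathcomp Require Export all_boot all_order all_algebra.
From mathcomp Require Export all_classical all_reals all_analysis.

Set Implicit Arguments.
Unset Strict Implicit.
Unset Printing Implicit Defensive.

Import Order.TTheory GRing.Theory Num.Theory.
Import numFieldNormedType.Exports.

Local Open Scope classical_set_scope.
Local Open Scope ring_scope.

(* Time is R_+ = [0, +oo[.  Paths, processes and coefficients are total
   functions of t : R, but every condition below only involves their values at
   t >= 0. *)

Section coefficients.
Context {R : realType}.
Implicit Type g : R -> R -> R.

Definition time_space : set (R * R) := `[0, +oo[%classic `*` [set: R].

Definition continuous_coef g :=
  {within time_space, continuous (fun p : R * R => g p.1 p.2)}.

Definition linearly_growing g :=
  exists2 C : R, 0 < C &
    forall t x : R, 0 <= t -> `|g t x| <= C * (1 + t + `|x|).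

Definition locally_lipschitz g :=
  forall K : set (R * R), compact K -> K `<=` time_space ->
    exists2 M : R, 0 < M &
      forall p q : R * R, K p -> K q ->
        `|g p.1 p.2 - g q.1 q.2| <= M * (`|p.1 - q.1| + `|p.2 - q.2|).

Definition lipschitz_snd g :=
  exists2 M : R, 0 < M &
    forall t x y : R, 0 <= t -> `|g t x - g t y| <= M * `|x - y|.

(* The difference quotient in time only uses times in R_+: the partial
   derivative is the usual one for t > 0 and the right derivative at t = 0. *)
Definition time_quotient g (t x s : R) : R := (g s x - g t x) / (s - t).

Definition derivable1 g (t x : R) :=
  cvg (time_quotient g t x s @[s --> within `[0, +oo[%classic t^']).

Definition partial1 g (t x : R) : R :=
  lim (time_quotient g t x s @[s --> within `[0, +oo[%classic t^']).

Definition derivable2 g (t x : R) := derivable (g t) x 1.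

Definition partial2 g (t x : R) : R := derive1 (g t) x.

Definition class_C11 g :=
  [/\ continuous_coef g,
      forall t x : R, 0 <= t -> derivable1 g t x,
      forall t x : R, 0 <= t -> derivable2 g t x,
      continuous_coef (partial1 g) &
      continuous_coef (partial2 g)].

End coefficients.

(* E carries the discrete topology and the discrete sigma-algebra, for which
   convergence means being eventually constant. *)
Section jump_process.
Context {R : realType} {d : measure_display} {T : measurableType d}.
Context {E : finType}.

Definition cadlag_path (j : R -> E) :=
  (forall t : R, 0 <= t -> \forall s \near t^'+, j s = j t) /\
  (forall t : R, 0 < t -> exists i, \forall s \near t^'-, j s = i).

Definition jump_times (j : R -> E) : set R :=
  [set t | 0 < t /\ ~ (\forall s \near t^'-, j s = j t)].

Definition jump_process (J : R -> T -> E) :=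
  [/\ forall (t : R) i, 0 <= t -> measurable [set w | J t w = i],
      forall w, cadlag_path (J^~ w) &
      forall w (a b : R), 0 <= a -> finite_set (jump_times (J^~ w) `&` `[a, b])].

End jump_process.

Section stieltjes.
Context {R : realType}.
Implicit Types (f h : R -> R).

Definition continuous_path f := {within `[0, +oo[, continuous f}.

Definition finite_variation f :=
  forall a b : R, 0 <= a -> a <= b -> bounded_variation a b f.

Definition continuous_fv f := continuous_path f /\ finite_variation f.

Lemma continuous_fvN f : continuous_fv f -> continuous_fv (\- f).
Proof.
move=> [cf vf]; split; last first.
  by move=> a b a0 ab; exact/bounded_variationN/vf.
by move=> x; apply: continuousN; exact: cf.
Qed.

Lemma continuous_path_right f t : continuous_path f -> 0 <= t ->
  f s @[s --> t^'+] --> f t.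
Proof.
move=> cf t0; have /subspace_continuousP/(_ t) := cf.
rewrite /= in_itv/= t0/= => /(_ isT) cft.
apply: cvg_trans cft; apply: cvg_app => A.
rewrite /at_right /within/= => tA.
apply: (@filterS _ (nbhs t) _ _ _ _ tA) => s /= {}tA ts.
by apply: tA; rewrite in_itv/= andbT (le_trans t0)// ltW.
Qed.

(* The negative variation function of f on [0, +oo[ (the library's neg_tv),
   extended by its value at 0 to negative times.  The positive variation
   function pos_tv 0 f of the library is neg_tv 0 (\- f), and
   f = pos_tv 0 f - neg_tv 0 f (bounded_variation_pos_neg_tvE). *)
Definition neg_variation f (hf : continuous_fv f) (t : R) : R :=
  fine (neg_tv 0 f (Num.max 0 t)).

Lemma neg_variation_nondecreasing f (hf : continuous_fv f) :
  nondecreasing (neg_variation hf).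
Proof.
move=> s t st; have m0 (u : R) : 0 <= Num.max 0 u by rewrite le_max lexx.
have mst : Num.max 0 s <= Num.max 0 t.
  by rewrite ge_max m0/= le_max st orbT.
apply: (fine_neg_tv_nondecreasing (hf.2 _ _ (lexx 0) (m0 t))) => //.
- by rewrite in_itv/= m0.
- by rewrite in_itv/= m0 lexx.
Qed.

Lemma neg_variation_right_continuous f (hf : continuous_fv f) :
  right_continuous (neg_variation hf).
Proof.
move=> t; rewrite /neg_variation; have [t0|t0] := ltP t 0.
  apply: cvg_near_cst; near=> s; congr (fine (neg_tv _ _ _)).
  by rewrite max_l ?ltW //; near: s; exact: nbhs_right_lt.
have t1 : t < t + 1 by rewrite ltrDl.
have := neg_tv_right_continuous t0 t1 (hf.2 _ _ (lexx 0) (le_trans t0 (ltW t1)))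
  (continuous_path_right hf.1 t0).
apply: cvg_trans; apply: near_eq_cvg.
near=> s => /=; rewrite max_r // (le_trans t0)//.
Unshelve. all: by end_near. Qed.

HB.instance Definition _ f (hf : continuous_fv f) :=
  isCumulative.Build R _ R (neg_variation hf)
    (@neg_variation_nondecreasing f hf)
    (@neg_variation_right_continuous f hf).

Definition pos_variation f (hf : continuous_fv f) : R -> R :=
  neg_variation (continuous_fvN hf).

HB.instance Definition _ f (hf : continuous_fv f) :=
  Cumulative.on (pos_variation hf).

(* The integral of h over ]0, t] with respect to df, through the Jordan
   decomposition of the signed measure df. *)
Definition stieltjes_integral f (hf : continuous_fv f) (t : R) h : R :=
  \int[lebesgue_stieltjes_measure (pos_variation hf)]_(s in `]0, t]) h s -
  \int[lebesgue_stieltjes_measure (neg_variation hf)]_(s in `]0, t]) h s.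

End stieltjes.

Section equation.
Context {R : realType} {E : finType}.

(* Along the paths j of J and f of the driver, x is a continuous solution on
   [0, +oo[ of the equation in integral form. *)
Definition pathwise_solution (mu sigma : E -> R -> R -> R) (x0 : R)
    (j : R -> E) (f : R -> R) (hf : continuous_fv f) (x : R -> R) :=
  [/\ continuous_path x,
      x 0 = x0 &
      forall t : R, 0 <= t ->
        x t = x0
          + \int[lebesgue_measure]_(s in `[0, t])
              (mu (j s) s (x s)
               - 2^-1 * sigma (j s) s (x s) * partial2 (sigma (j s)) s (x s))
          + stieltjes_integral hf t (fun s => sigma (j s) s (x s))].

End equation.

(* Main.v *)
(* Along a path the equation is an integral equation
     x t = x0 + \sum_i \int_]0, t] g_i s (x s) dG_i s
   driven by finitely many continuous nondecreasing G_i (time and the two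
   variation functions of the driver), with g_i of linear growth and locally
   Lipschitz in space.  Let a be the sum of the G_i.  Since
   \int_]0, t] e^(l a) da <= e^(l a t) / l, for l large the Picard map preserves
   a bound of the form |x| <= A e^(l a), which replaces the missing global
   Lipschitz condition, and contracts by 1/2 the sup norm weighted by e^(-l a)
   on the resulting bounded set.  This gives pathwise existence and uniqueness.
   The Picard iterates are random variables because each integral is a limit of
   Riemann sums, in which the two variation functions recombine into increments
   of the driver itself. *)
Require Import Defs.
From mathcomp Require Import measurable_realfun ring lra.
Import Order.TTheory GRing.Theory Num.Theory.
Import numFieldNormedType.Exports.
Local Open Scope classical_set_scope.
Local Open Scope ring_scope.

Set Implicit Arguments.
Unset Strict Implicit.

(** * Riemann sums of Stieltjes integrals *)

Section riemann_sums.
Context {R : realType}.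
Implicit Types (G : cumulative R R) (h : R -> R) (t : R) (n k : nat).

Definition grid t n k : R := t * (k%:R / n.+1%:R).

Lemma grid0 t n : grid t n 0 = 0.
Proof. by rewrite /grid mul0r mulr0. Qed.

Lemma gridn t n : grid t n n.+1 = t.
Proof. by rewrite /grid divff ?mulr1// pnatr_eq0. Qed.

Lemma le_grid t n k l : 0 <= t -> (k <= l)%N -> grid t n k <= grid t n l.
Proof.
move=> t0 kl; rewrite ler_wpM2l// ler_wpM2r ?invr_ge0 ?ler0n//.
by rewrite ler_nat.
Qed.

Lemma grid_ge0 t n k : 0 <= t -> 0 <= grid t n k.
Proof. by move=> t0; rewrite -(grid0 t n) le_grid. Qed.

Lemma grid_le t n k : 0 <= t -> (k <= n.+1)%N -> grid t n k <= t.
Proof. by move=> t0 kn; rewrite -[leRHS](gridn t n) le_grid. Qed.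

Lemma grid_step t n k : grid t n k.+1 - grid t n k = t / n.+1%:R.
Proof. by rewrite /grid -mulrBr -mulrBl -natrB// subSnn mul1r. Qed.

(** The cell is that of the least [k] whose right end reaches [s]; minimality gives the strict
    inequality at its left end. *)
Lemma grid_cell t n s : 0 < s -> s <= t ->
  exists2 k, (k < n.+1)%N & grid t n k < s <= grid t n k.+1.
Proof.
move=> s0 st; have t0 : 0 <= t by rewrite ltW// (lt_le_trans s0).
have ex : exists k, s <= grid t n k.+1 by exists n; rewrite gridn.
case: (ex_minnP ex) => k sk kmin; exists k.
  by apply: kmin; rewrite gridn.
rewrite sk andbT; case: k kmin {sk} => [|k] kmin; first by rewrite grid0.
by rewrite ltNge; apply/negP => /kmin; rewrite ltnn.
Qed.

Lemma lebesgue_stieltjes_itv G (a b : R) : a <= b ->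
  lebesgue_stieltjes_measure G `]a, b] = (G b - G a)%:E.
Proof.
move=> ab; rewrite /lebesgue_stieltjes_measure /measure_extension.
rewrite measurable_mu_extE/= ?wlength_itv_bnd//; exact: is_ocitv.
Qed.

Lemma lebesgue_stieltjes_itv_lty G (a b : R) :
  (lebesgue_stieltjes_measure G `]a, b] < +oo)%E.
Proof.
have [ab|ba] := leP a b; first by rewrite lebesgue_stieltjes_itv// ltry.
by rewrite set_itv_ge ?measure0// bnd_simp -leNgt ltW.
Qed.

Lemma measurable_itvoc (a b : R) :
  measurable (`]a, b]%classic : set (measurableTypeR R)).
Proof. exact: measurable_itv. Qed.

Definition riemann_sum h G t n (b : bool) :=
  \sum_(k < n.+1) h (grid t n (k + b)) * (G (grid t n k.+1) - G (grid t n k)).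

(** The integral of this step function over ]0, t] is the Riemann sum, which reduces convergence of
    the sums to dominated convergence. *)
Let step h t n (b : bool) : R -> R := fun s =>
  \sum_(k < n.+1) h (grid t n (k + b)) *
    \1_(`]grid t n k, grid t n k.+1]%classic) s.

Let step_cell h t n b s k : 0 <= t -> (k < n.+1)%N ->
  grid t n k < s <= grid t n k.+1 -> step h t n b s = h (grid t n (k + b)).
Proof.
move=> t0 kn /andP[ks sk]; rewrite /step (bigD1 (Ordinal kn))//= big1 ?addr0.
  by rewrite indicE mem_set ?mulr1//= in_itv/= ks sk.
move=> i; rewrite -val_eqE/= neq_lt => /orP[ik|ki].
  rewrite indicE memNset ?mulr0//= in_itv/= => /andP[_ si].
  by have := lt_le_trans ks si; rewrite ltNge le_grid.
rewrite indicE memNset ?mulr0//= in_itv/= => /andP[si _].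
by have := lt_le_trans si sk; rewrite ltNge le_grid.
Qed.

Let measurable_step h t n b :
  measurable_fun [set: measurableTypeR R] (step h t n b).
Proof.
by apply: measurable_sum => k; apply: measurable_funM.
Qed.

Let integrable_indic h G t n (b : bool) (k : 'I_n.+1) :
  (lebesgue_stieltjes_measure G).-integrable `]0, t]
    (fun s => (h (grid t n (k + b)) *
      \1_(`]grid t n k, grid t n k.+1]%classic) s)%:E).
Proof.
have := @measurable_bounded_integrable _ _ _ (lebesgue_stieltjes_measure G)
  (fun s => h (grid t n (k + b)) *
    \1_(`]grid t n k, grid t n k.+1]%classic) s) `]0, t]%classic.
apply.
- exact: measurable_itvoc.
- exact: lebesgue_stieltjes_itv_lty.
- by apply: measurable_funTS; apply: measurable_funM.
- exists `|h (grid t n (k + b))|; split => // M hM s _ /=.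
  rewrite normrM (le_trans _ (ltW hM))// ler_piMr// indicE.
  by case: (_ \in _); rewrite ?normr1// normr0.
Qed.

Let integral_step h G t n b : 0 <= t ->
  (\int[lebesgue_stieltjes_measure G]_(s in `]0%R, t]) (step h t n b s)%:E =
   (riemann_sum h G t n b)%:E)%E.
Proof.
move=> t0; under eq_integral do rewrite -sumEFin.
rewrite integral_sum//=.
rewrite -sumEFin; apply: eq_bigr => k _.
under eq_integral do rewrite EFinM.
rewrite integralZl//; last first.
  have := integrable_indic (cst 1) G t b k; rewrite /cst/=.
  by under [X in _.-integrable _ X]eq_fun do rewrite mul1r.
rewrite integral_indic; [|exact: measurable_itvoc|exact: measurable_itvoc].
rewrite setIidl.
  rewrite [RHS]EFinM; congr (_ * _)%E.
  by apply: lebesgue_stieltjes_itv; rewrite le_grid.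
move=> s/=; rewrite !in_itv/= => /andP[ks sk]; apply/andP; split.
  by rewrite (le_lt_trans _ ks)// grid_ge0.
by rewrite (le_trans sk)// grid_le.
Qed.

(* With [b = true] a cell is sampled at its right end, with [b = false] at its
   left end. *)
Lemma riemann_sum_cvg h G t M (b : bool) : 0 <= t ->
  (forall s, 0 <= s <= t -> `|h s| <= M) ->
  (forall s, 0 < s <= t ->
    if b then h @ s^'+ --> h s else h @ s^'- --> h s) ->
  (lebesgue_stieltjes_measure G).-integrable `]0, t] (EFin \o h) /\
  riemann_sum h G t n b @[n --> \oo] -->
    \int[lebesgue_stieltjes_measure G]_(s in `]0, t]) h s.
Proof.
move=> t0 hM hcont.
have stepM n s : `]0, t]%classic s -> `|step h t n b s| <= M.
  rewrite /= in_itv/= => /andP[s0 st].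
  have [k kn ks] := grid_cell n s0 st; rewrite (step_cell _ _ t0 kn ks).
  apply: hM; rewrite grid_ge0// grid_le//.
  by rewrite (leq_trans _ kn)// -addn1 leq_add2l leq_b1.
have step_cvg s : `]0, t]%classic s -> step h t n b s @[n --> \oo] --> h s.
  rewrite /= in_itv/= => /andP[s0 st]; apply/cvgrPdist_lt => e e0.
  (* The one-sided limit only controls [u] on one open side of [s]; the case [u = s] is added by
     hand, since [s] may itself be a grid point. *)
  have [d d0 hd] : exists2 d, 0 < d & forall u, `|s - u| < d ->
      (if b then s <= u else u <= s) -> `|h s - h u| < e.
    have := hcont s; rewrite s0 st => /(_ isT) {}hcont.
    clear stepM; case: b hcont => /cvgrPdist_lt/(_ _ e0)[d/= d0 hd];
      exists d => //.
      move=> u sud; rewrite le_eqVlt => /predU1P[<-|su].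
        by rewrite subrr normr0.
      exact: hd.
    move=> u sud; rewrite le_eqVlt => /predU1P[->|su].
      by rewrite subrr normr0.
    exact: hd.
  (* The sample point of the cell containing [s] lies within one mesh of [s], on the side selected
     by [b]. *)
  have /cvgrPdist_lt/(_ _ d0) : t * n.+1%:R^-1 @[n --> \oo] --> t * 0.
    apply: cvgM; [exact: cvg_cst|exact: cvg_harmonic].
  apply: filterS => n; rewrite mulr0 sub0r normrN ger0_norm; last first.
    by rewrite mulr_ge0// invr_ge0.
  move=> tnd; have [k kn /[dup] ks /andP[ks1 ks2]] := grid_cell n s0 st.
  rewrite (step_cell _ _ t0 kn ks); have := grid_step t n k => gs.
  clear stepM hcont; apply: hd; last first.
    by case: b; rewrite ?addn1// addn0 ltW.
  case: b; rewrite ?addn1 ?addn0.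
    by rewrite distrC ger0_norm ?subr_ge0// (le_lt_trans _ tnd)//
      -gs lerD2l lerN2 ltW.
  by rewrite gtr0_norm ?subr_gt0// (le_lt_trans _ tnd)// -gs lerD2r.
have mstep n : measurable_fun (`]0, t]%classic : set (measurableTypeR R))
    (step h t n b).
  by apply: measurable_funTS; exact: measurable_step.
(* Measurability of [h] is not assumed: it comes from the pointwise limit of step functions. *)
have mh : measurable_fun (`]0, t]%classic : set (measurableTypeR R)) h.
  exact: measurable_fun_cvg step_cvg.
have iM : (lebesgue_stieltjes_measure G).-integrable `]0, t] (cst M%:E).
  apply: (@measurable_bounded_integrable _ _ _ _ (cst M)) => //.
    exact: lebesgue_stieltjes_itv_lty.
  by exists `|M|; split => // N MN s _ /=; exact: ltW.
have [||ih _ cvgh] := dominated_convergence (measurable_itvoc 0 t)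
  (fun n => (measurable_EFinP _ _).2 (mstep n)) ((measurable_EFinP _ _).2 mh)
  _ iM.
- apply: aeW => s st; apply: cvg_EFin; first exact: nearW.
  exact: step_cvg.
- by apply: aeW => s n st; rewrite lee_fin stepM.
- split => //.
  have /fine_cvgP[_] : (riemann_sum h G t n b)%:E @[n --> \oo] -->
      (\int[lebesgue_stieltjes_measure G]_(s in `]0%R, t]) h s)%:E.
    rewrite /Rintegral fineK; last exact: integrable_fin_num.
    move: cvgh; apply: cvg_trans; apply: near_eq_cvg; near=> n => /=.
    by rewrite integral_step.
  exact: cvg_trans.
Unshelve. all: by end_near. Qed.

End riemann_sums.

(** * Estimates for Stieltjes integrals *)

Section stieltjes_estimates.
Context {R : realType}.
Implicit Types (G : cumulative R R) (h : R -> R) (t : R).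

(** The regularity of a coefficient evaluated along a càdlàg switching path and a continuous state.
    It is enough for right-sampled Riemann sums to converge; positive times suffice for right
    continuity because the integrals are over ]0, t]. *)
Definition rc_locally_bounded h :=
  (forall s, 0 < s -> h @ s^'+ --> h s) /\
  (forall t, exists M, forall s, 0 <= s <= t -> `|h s| <= M).

Lemma continuous_bounded_itv h t : continuous h ->
  exists M, forall s, 0 <= s <= t -> `|h s| <= M.
Proof.
move=> ch; have [t0|t0] := leP 0 t; last first.
  by exists 0 => s /andP[s0 /(le_trans s0)]; rewrite leNgt t0.
have [|c _ cmax] := @EVT_max R (fun s => `|h s|) 0 t t0.
  apply: continuous_subspaceT => s.
  by apply: continuous_comp; [exact: ch|exact: norm_continuous].
by exists `|h c| => s st; apply: cmax; rewrite in_itv.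
Qed.

Lemma continuous_rc_locally_bounded h : continuous h -> rc_locally_bounded h.
Proof.
move=> ch; split => [s _|t]; last exact: continuous_bounded_itv.
exact/cvg_at_right_filter/ch.
Qed.

Lemma rclb_cvg G h t : 0 <= t -> rc_locally_bounded h ->
  riemann_sum h G t n true @[n --> \oo] -->
    \int[lebesgue_stieltjes_measure G]_(s in `]0, t]) h s.
Proof.
move=> t0 [ch /(_ t)[M hM]].
by have [|] := @riemann_sum_cvg R h G t M true t0 hM => // s /andP[/ch].
Qed.

Lemma rclb_integrable G h t : 0 <= t -> rc_locally_bounded h ->
  (lebesgue_stieltjes_measure G).-integrable `]0, t] (EFin \o h).
Proof.
move=> t0 [ch /(_ t)[M hM]].
by have [|] := @riemann_sum_cvg R h G t M true t0 hM => // s /andP[/ch].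
Qed.

(** The difference is the integral over ]s, t], a set of mass [G t - G s]. When [G] is continuous
    this yields continuity of the integral in its upper limit. *)
Lemma dist_integral_le G h (s t M : R) :
  rc_locally_bounded h -> 0 <= s -> s <= t ->
  (forall u, 0 < u <= t -> `|h u| <= M) ->
  `|\int[lebesgue_stieltjes_measure G]_(u in `]0, t]) h u -
    \int[lebesgue_stieltjes_measure G]_(u in `]0, s]) h u| <= M * (G t - G s).
Proof.
move=> rh s0 st hM; have t0 := le_trans s0 st.
have E : `]0, t]%classic = `]0, s]%classic `|` `]s, t]%classic :> set R.
  by rewrite -itv_bndbnd_setU// bnd_simp.
have ih := rclb_integrable G t0 rh.
rewrite [X in `|X - _|](_ : _ =
  \int[lebesgue_stieltjes_measure G]_(u in `]0, s]) h u +
  \int[lebesgue_stieltjes_measure G]_(u in `]s, t]) h u); last first.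
  rewrite E Rintegral_setU//; [by rewrite -E|].
  apply/(@disj_setPS R) => y [/=]; rewrite 2!in_itv/= => /andP[_ ys] /andP[].
  by rewrite ltNge ys.
rewrite addrAC subrr add0r.
have ist : (lebesgue_stieltjes_measure G).-integrable `]s, t] (EFin \o h).
  by apply: integrableS ih => //; rewrite E; exact: subsetUr.
have iM : (lebesgue_stieltjes_measure G).-integrable `]s, t] (EFin \o cst M).
  apply: (@measurable_bounded_integrable _ _ _ _ (cst M)) => //.
    exact: lebesgue_stieltjes_itv_lty.
  by exists `|M|; split => // N MN u _; exact: ltW.
rewrite (le_trans (le_normr_Rintegral _ _))//.
rewrite (@le_trans _ _ (\int[lebesgue_stieltjes_measure G]_(u in `]s, t]) M))//.
  apply: le_Rintegral => //.
    exact: integrable_norm.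
  move=> u; rewrite /= in_itv/= => /andP[su ut]; apply: hM.
  by rewrite ut (le_lt_trans s0).
suff mst : fine (lebesgue_stieltjes_measure G `]s, t]%classic) = G t - G s.
  by rewrite Rintegral_cst// -mst.
by rewrite -[RHS]/(fine (G t - G s)%:E) lebesgue_stieltjes_itv.
Qed.

Lemma cvg_sumr (I : finType) (T : Type) (F : set_system T) (FF : Filter F)
    (f : I -> T -> R) (l : I -> R) :
  (forall i, f i x @[x --> F] --> l i) ->
  \sum_i f i x @[x --> F] --> \sum_i l i.
Proof. by move=> fl; apply: cvg_big => //; exact: add_continuous. Qed.

(** The sum of the integrators is normalised to vanish at 0, so the weight is 1 there and at least 1
    afterwards when [l] is nonnegative. *)
Definition expweight (I : finType) (G : I -> cumulative R R) (l s : R) : R :=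
  expR (l * \sum_i (G i s - G i 0)).

Lemma continuous_expweight (I : finType) (G : I -> cumulative R R) l :
  (forall i, continuous (G i)) -> continuous (expweight G l).
Proof.
move=> cG s; apply: continuous_comp; last exact: continuous_expR.
apply: cvgM; first exact: cvg_cst.
by apply: cvg_sumr => i; apply: cvgB; [exact: cG|exact: cvg_cst].
Qed.

Lemma le_expweight (I : finType) (G : I -> cumulative R R) l s t :
  0 <= l -> s <= t -> expweight G l s <= expweight G l t.
Proof.
move=> l0 st; rewrite ler_expR ler_wpM2l// ler_sum// => i _.
by rewrite lerD2r cumulative_is_nondecreasing.
Qed.

Lemma expweight_ge1 (I : finType) (G : I -> cumulative R R) l s :
  0 <= l -> 0 <= s -> 1 <= expweight G l s.
Proof.
move=> l0 s0; rewrite (le_trans _ (le_expweight G l0 s0))//.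
by rewrite /expweight big1 ?mulr0 ?expR0// => i _; rewrite subrr.
Qed.

(* Left Riemann sums of [expR (l * a)] against [a] telescope up to the
   inequality [1 + x <= expR x]. *)
Lemma sum_integral_expweight (I : finType) (G : I -> cumulative R R) (l t : R) :
  0 < l -> 0 <= t -> (forall i, continuous (G i)) ->
  \sum_i \int[lebesgue_stieltjes_measure (G i)]_(s in `]0, t])
    expweight G l s <= expweight G l t / l.
Proof.
move=> l0 t0 cG; pose w := expweight G l; rewrite -/(w t).
have cw : continuous w := continuous_expweight cG.
have [M wM] := continuous_bounded_itv t cw.
have : \sum_i riemann_sum w (G i) t n false @[n --> \oo] -->
    \sum_i \int[lebesgue_stieltjes_measure (G i)]_(s in `]0, t]) w s.
  apply: cvg_sumr => i.
  have [|//] := @riemann_sum_cvg R w (G i) t M false t0 wM.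
  by move=> s _; exact/cvg_at_left_filter/cw.
move=> /[dup] /cvg_lim <- // cv; apply: limr_le.
  by apply/cvg_ex; eexists; exact: cv.
apply: nearW => n; rewrite exchange_big/=.
pose a s := \sum_i (G i s - G i 0).
(* On a cell from u to v, w(u) (a(v) - a(u)) is at most (w(v) - w(u)) / l. The sum telescopes, and
   the nonnegative term w(0) is dropped. *)
rewrite (@le_trans _ _ (\sum_(k < n.+1)
    (w (grid t n k.+1) - w (grid t n k)) / l))//; last first.
  rewrite -mulr_suml.
  rewrite -(big_mkord xpredT (fun k => w (grid t n k.+1) - w (grid t n k))).
  rewrite telescope_sumr// gridn ler_pM2r ?invr_gt0// gerBl; exact: expR_ge0.
apply: ler_sum => k _; rewrite addn0 -mulr_sumr ler_pdivlMr//.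
have -> : \sum_i (G i (grid t n k.+1) - G i (grid t n k)) =
    a (grid t n k.+1) - a (grid t n k).
  by rewrite /a -sumrB; apply: eq_bigr => i _; rewrite opprB addrA subrK.
set u := grid t n k; set v := grid t n k.+1.
have -> : w v = w u * expR (l * (a v - a u)).
  by rewrite /w -expRD -mulrDr addrC subrK.
rewrite -[X in _ <= _ - X]mulr1 -mulrBr -mulrA ler_wpM2l ?expR_ge0//.
by rewrite lerBrDl mulrC expR_ge1Dx.
Qed.

End stieltjes_estimates.

(** * Sequences with geometrically decreasing increments *)

Section geometric_cauchy.
Context {R : realType}.

Lemma geometric_cvg (u : nat -> R) (K : R) :
  (forall n, `|u n.+1 - u n| <= K * 2^-1 ^+ n) ->
  cvgn u /\ forall n, `|limn u - u n| <= K * 2 * 2^-1 ^+ n.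
Proof.
move=> uK.
have cu : cvgn u.
  have : cvgn (series (fun n => u n.+1 - u n)).
    apply: normed_cvg; apply: (@series_le_cvg _ _ (geometric K 2^-1)).
    - by move=> n; exact: normr_ge0.
    - by move=> n; rewrite (le_trans _ (uK n)).
    - exact: uK.
    - by apply: is_cvg_geometric_series; rewrite ger0_norm ?invf_lt1 ?ltr1n.
  have -> : series (fun n => u n.+1 - u n) = u \- cst (u 0%N).
    by apply/funext => n; rewrite /series/= telescope_sumr.
  move=> /cvg_ex[l ul]; apply/cvg_ex; exists (l + u 0%N).
  have E : (fun n => (u \- cst (u 0%N)) n + u 0%N) = u.
    by apply/funext => n; rewrite /= subrK.
  by rewrite -[X in X @ _]E; apply: cvgD; [exact: ul|exact: cvg_cst].
split => // n.
(* The subtracted remainder makes the induction close: a new increment costs K / 2^(n+k), exactly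
   what the remainder loses from one index to the next. *)
have uK2 k : `|u (n + k)%N - u n| <=
    K * 2 * 2^-1 ^+ n - K * 2 * 2^-1 ^+ (n + k).
  elim: k => [|k IH]; first by rewrite addn0 !subrr normr0.
  have -> : u (n + k.+1)%N - u n =
    (u (n + k).+1 - u (n + k)%N) + (u (n + k)%N - u n).
    by rewrite addnS addrA subrK.
  rewrite (le_trans (ler_normD _ _))// (le_trans (lerD (uK _) IH))//.
  rewrite addnS exprS; set a := 2^-1 ^+ (n + k); lra.
have K0 : 0 <= K by have := uK 0%N; rewrite expr0 mulr1; exact: le_trans.
have cun : `|u k - u n| @[k --> \oo] --> `|limn u - u n|.
  by apply: cvg_norm; apply: cvgB; [exact: cu|exact: cvg_cst].
rewrite -(cvg_lim _ cun)//; apply: limr_le.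
  by apply/cvg_ex; eexists; exact: cun.
near=> k; have nk : (n <= k)%N by near: k; exact: nbhs_infty_ge.
rewrite -(subnKC nk) (le_trans (uK2 _))// gerBl.
by rewrite mulr_ge0// ?mulr_ge0// exprn_ge0// invr_ge0.
Unshelve. all: by end_near. Qed.

End geometric_cauchy.

(** * Continuity of Stieltjes integrals in the upper limit *)

Section integral_continuity.
Context {R : realType}.

Lemma rclbB (h k : R -> R) : rc_locally_bounded h -> rc_locally_bounded k ->
  rc_locally_bounded (fun s => h s - k s).
Proof.
move=> [ch bh] [ck bk]; split => [s s0|t].
  by apply: cvgB; [exact: ch|exact: ck].
have [M hM] := bh t; have [N kN] := bk t; exists (M + N) => s st.
by rewrite (le_trans (ler_normB _ _))// lerD// ?hM ?kN.
Qed.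

Lemma continuous_stieltjes_integral (G : cumulative R R) (h : R -> R) :
  continuous G -> rc_locally_bounded h ->
  continuous (fun t : R =>
    \int[lebesgue_stieltjes_measure G]_(s in `]0, t]) h s).
Proof.
(* For a negative upper limit the domain is empty, so clamping the time at 0 leaves the integral
   unchanged and makes [dist_integral_le] applicable around any real [t]. *)
move=> cG rh t; pose p (s : R) := Num.max 0 s.
have p0 s : 0 <= p s by rewrite le_max lexx.
have pE s : \int[lebesgue_stieltjes_measure G]_(u in `]0, s]) h u =
    \int[lebesgue_stieltjes_measure G]_(u in `]0, p s]) h u.
  rewrite /p; have [//|s0] := leP 0 s.
  by rewrite !set_itv_ge// bnd_simp ?ltxx// -leNgt ltW.
have [M hM] := rh.2 (p t + 1).
have dist_le s u : p s <= p u -> p u <= p t + 1 ->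
    `|\int[lebesgue_stieltjes_measure G]_(v in `]0, u]) h v -
      \int[lebesgue_stieltjes_measure G]_(v in `]0, s]) h v| <=
    M * `|G (p u) - G (p s)|.
  move=> su ut; rewrite (pE s) (pE u).
  have hM' v : 0 < v <= p u -> `|h v| <= M.
    by move=> /andP[v0 vu]; apply: hM; rewrite ltW//=; exact: le_trans vu ut.
  rewrite (le_trans (dist_integral_le G rh (p0 s) su hM'))//.
  by rewrite ger0_norm// subr_ge0 cumulative_is_nondecreasing.
have M0 : 0 <= M by rewrite (le_trans _ (hM 0 _))// lexx/= addr_ge0.
have cp : {for t, continuous p}.
  by apply: continuous_max; [exact: cvg_cst|exact: cvg_id].
have cGp : G (p s) @[s --> t] --> G (p t).
  by apply: continuous_comp; [exact: cp|exact: cG].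
apply/cvgrPdist_lt => e e0.
(* [M] may be 0, hence the division by [M + 1]. *)
have eM : 0 < e / (M + 1) by rewrite divr_gt0// ltr_wpDl.
near=> s; rewrite (@le_lt_trans _ _ (M * `|G (p t) - G (p s)|))//; last first.
  rewrite (@le_lt_trans _ _ (M * (e / (M + 1))))//.
    rewrite ler_wpM2l// ltW//; near: s.
    by move/cvgrPdist_lt : cGp => /(_ _ eM).
  by rewrite mulrCA gtr_pMr// ltr_pdivrMr ?mul1r ?ltrDl// ltr_wpDl.
have st : p s <= p t + 1.
  rewrite ltW// -ltrBlDl; near: s.
  move/cvgrPdist_lt : cp => /(_ 1 ltr01); apply: filterS => s.
  by rewrite distrC; exact/le_lt_trans/ler_norm.
have [ts|ts] := leP (p t) (p s).
  by rewrite distrC (distrC (G _)) dist_le.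
by apply: dist_le; [exact: ltW|rewrite lerDl].
Unshelve. all: by end_near. Qed.

End integral_continuity.

(** * Picard iteration for finitely many integrators *)

Section picard.
Context {R : realType} {I : finType} (G : I -> cumulative R R).
Context (g : I -> R -> R -> R) (x0 : R).
Context (cG : forall i, continuous (G i)).
Context (g_rc : forall i (x : R -> R), continuous x ->
  forall s, 0 < s -> g i u (x u) @[u --> s^'+] --> g i s (x s)).
Context (g_growth : exists2 C : R, 0 < C &
  forall i (t x : R), 0 <= t -> `|g i t x| <= C * (1 + t + `|x|)).
Context (g_lip : forall T r : R, exists2 L : R, 0 < L &
  forall i (t x y : R), 0 <= t <= T -> `|x| <= r -> `|y| <= r ->
    `|g i t x - g i t y| <= L * `|x - y|).
Implicit Types (x y : R -> R) (s t T C L A K l r : R).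

(** For [t <= 0] the integrals are over empty sets and the value is [x0]; the iterates are thus
    continuous on the whole line, and no one-sided topology at 0 is involved. *)
Definition picard_map x t :=
  x0 + \sum_i \int[lebesgue_stieltjes_measure (G i)]_(s in `]0, t]) g i s (x s).

Fixpoint picard (n : nat) : R -> R :=
  if n is n'.+1 then picard_map (picard n') else cst x0.

Lemma rclb_coef x i : continuous x -> rc_locally_bounded (fun s => g i s (x s)).
Proof.
move=> cx; split => [s|t]; first exact: g_rc.
have [C C0 gC] := g_growth; have [M xM] := continuous_bounded_itv t cx.
exists (C * (1 + t + M)) => s /[dup] st /andP[s0 st'].
by rewrite (le_trans (gC _ _ _ s0))// ler_pM2l// lerD ?lerD2l ?xM.
Qed.

Lemma picard_map_le0 x t : t <= 0 -> picard_map x t = x0.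
Proof.
move=> t0; rewrite /picard_map big1 ?addr0// => i _.
by rewrite set_itv_ge ?Rintegral_set0// bnd_simp -leNgt.
Qed.

Lemma continuous_picard_map x : continuous x -> continuous (picard_map x).
Proof.
move=> cx t; apply: cvgD; first exact: cvg_cst.
apply: cvg_sumr => i; apply: continuous_stieltjes_integral; first exact: cG.
exact: rclb_coef.
Qed.

Lemma continuous_picard n : continuous (picard n).
Proof.
by elim: n => [|n IH] /=; [exact: cst_continuous|exact: continuous_picard_map].
Qed.

Lemma picard_le0 n t : t <= 0 -> picard n t = x0.
Proof. by case: n => [//|n] t0; exact: picard_map_le0. Qed.

(** Integrating against the weight gains a factor 1 / l. With l = 2C this gives the a priori bound,
    with l = 2L the contraction. *)
Lemma norm_sum_integral_le (h : I -> R -> R) K l t :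
  0 <= K -> 0 < l -> 0 <= t ->
  (forall i, rc_locally_bounded (h i)) ->
  (forall i s, 0 <= s <= t -> `|h i s| <= K * expweight G l s) ->
  `|\sum_i \int[lebesgue_stieltjes_measure (G i)]_(s in `]0, t]) h i s| <=
    K / l * expweight G l t.
Proof.
move=> K0 l0 t0 rh hK.
have rw : rc_locally_bounded (expweight G l).
  exact/continuous_rc_locally_bounded/continuous_expweight.
have rKw : rc_locally_bounded (fun s => K * expweight G l s).
  apply: continuous_rc_locally_bounded => s; apply: cvgM; first exact: cvg_cst.
  exact: continuous_expweight.
rewrite (le_trans (ler_norm_sum _ _ _))//.
rewrite (@le_trans _ _ (K * \sum_i
    \int[lebesgue_stieltjes_measure (G i)]_(s in `]0, t]) expweight G l s))//.
  rewrite mulr_sumr; apply: ler_sum => i _.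
  have ih := rclb_integrable (G i) t0 (rh i).
  rewrite -RintegralZl//; last exact: rclb_integrable.
  rewrite (le_trans (le_normr_Rintegral _ _))//.
  apply: le_Rintegral => //; first exact: integrable_norm.
    exact: rclb_integrable.
  by move=> s; rewrite /= in_itv/= => /andP[s0 st]; rewrite hK// st ltW.
rewrite -mulrA ler_wpM2l// mulrC; exact: sum_integral_expweight.
Qed.

(** The bound is put on 1 + T + |x| because this quantity dominates the growth condition directly.
    The integral takes one half of A, the initial data 1 + T + |x0| the other half. *)
Lemma picard_map_growth C T A x : 0 < C ->
  (forall i t (z : R), 0 <= t -> `|g i t z| <= C * (1 + t + `|z|)) ->
  0 <= T -> continuous x -> 1 + T + `|x0| <= A / 2 ->
  (forall t, 0 <= t <= T -> 1 + T + `|x t| <= A * expweight G (2 * C) t) ->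
  forall t, 0 <= t <= T ->
    1 + T + `|picard_map x t| <= A * expweight G (2 * C) t.
Proof.
move=> C0 gC T0 cx A2 xA t /andP[t0 tT].
have C20 : 0 < 2 * C by rewrite mulr_gt0.
have CA0 : 0 <= C * A.
  rewrite mulr_ge0 ?(ltW C0)// -(pmulr_lge0 _ (_ : 0 < 2^-1)) ?invr_gt0//.
  by rewrite (le_trans _ A2)// !addr_ge0.
have gA i s : 0 <= s <= t -> `|g i s (x s)| <= C * A * expweight G (2 * C) s.
  move=> /andP[s0 st]; rewrite (le_trans (gC _ _ _ s0))// -mulrA ler_pM2l//.
  rewrite (le_trans _ (xA s _))// ?s0 ?(le_trans st)//.
  by rewrite lerD2r lerD2l (le_trans st).
have := norm_sum_integral_le CA0 C20 t0 (fun i => rclb_coef i cx) gA.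
have -> : C * A / (2 * C) = A / 2 by field; rewrite gt_eqF.
set S := \sum_i _; set w := expweight _ _ _ => Sle.
have w1 : 1 <= w by rewrite expweight_ge1// ltW.
have := ler_normD x0 S; rewrite -/(picard_map x t).
have : A / 2 <= A / 2 * w.
  by rewrite ler_peMr// (le_trans _ A2)// !addr_ge0.
lra.
Qed.

Lemma picard_bounded T :
  exists r, forall n t, 0 <= t <= T -> `|picard n t| <= r.
Proof.
have [T0|T0] := leP 0 T; last first.
  by exists 0 => n t /andP[t0 /(le_trans t0)]; rewrite leNgt T0.
(* The least [A] that [picard_map_growth] accepts. *)
have [C C0 gC] := g_growth; pose A := 2 * (1 + T + `|x0|).
have A0 : 0 <= A by rewrite mulr_ge0// !addr_ge0.
have C20 : 0 <= 2 * C by rewrite mulr_ge0// ltW.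
exists (A * expweight G (2 * C) T) => n t tT.
have xA : forall t, 0 <= t <= T ->
    1 + T + `|picard n t| <= A * expweight G (2 * C) t.
  elim: n => [|n IH] s sT.
    rewrite /= (@le_trans _ _ A)//; last first.
      by rewrite ler_peMr// expweight_ge1//; case/andP: sT.
    by rewrite /A /cst ler_peMl ?ler1n// !addr_ge0.
  apply: picard_map_growth => //; first exact: continuous_picard.
  by rewrite /A mulrC mulKf.
have := xA t tT; case/andP : tT => t0 tT.
have : A * expweight G (2 * C) t <= A * expweight G (2 * C) T.
  by rewrite ler_wpM2l// le_expweight.
lra.
Qed.

(** The common bound [r] gives access to a local Lipschitz constant; the weight with parameter 2L
    turns the factor L into 1/2. *)
Lemma picard_map_contract L T r K x y : 0 < L ->
  (forall i (t x y : R), 0 <= t <= T -> `|x| <= r -> `|y| <= r ->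
    `|g i t x - g i t y| <= L * `|x - y|) ->
  continuous x -> continuous y ->
  (forall t, 0 <= t <= T -> `|x t| <= r) ->
  (forall t, 0 <= t <= T -> `|y t| <= r) ->
  (forall t, 0 <= t <= T -> `|x t - y t| <= K * expweight G (2 * L) t) ->
  forall t, 0 <= t <= T ->
    `|picard_map x t - picard_map y t| <= K / 2 * expweight G (2 * L) t.
Proof.
move=> L0 gL cx cy xr yr xyK t /andP[t0 tT].
have L20 : 0 < 2 * L by rewrite mulr_gt0.
have -> : picard_map x t - picard_map y t =
    \sum_i \int[lebesgue_stieltjes_measure (G i)]_(s in `]0, t])
      (g i s (x s) - g i s (y s)).
  rewrite /picard_map opprD addrACA subrr add0r -sumrB; apply: eq_bigr => i _.
  by rewrite RintegralB//; apply: rclb_integrable => //; exact: rclb_coef.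
have -> : K / 2 = L * K / (2 * L) by field; rewrite gt_eqF.
apply: norm_sum_integral_le => //.
  (* [K] is nonnegative since its product with a positive weight bounds a norm. *)
  have := xyK t; rewrite t0 => /(_ tT) /(le_trans (normr_ge0 _)).
  by rewrite pmulr_lge0 ?expR_gt0// => ?; rewrite mulr_ge0// ltW.
  by move=> i; apply: rclbB; exact: rclb_coef.
move=> i s /andP[s0 st]; have sT : 0 <= s <= T by rewrite s0 (le_trans st).
rewrite (le_trans (gL _ _ _ _ sT (xr _ sT) (yr _ sT)))//.
by rewrite -mulrA ler_pM2l// xyK.
Qed.

Lemma picard_step T : exists K : R, forall n t, t <= T ->
  `|picard n.+1 t - picard n t| <= K * 2^-1 ^+ n.
Proof.
have [r xr] := picard_bounded T; have [L L0 gL] := g_lip T r.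
have [T0|T0] := leP 0 T; last first.
  exists 0 => n t tT; have t0 := le_trans tT (ltW T0).
  by rewrite !picard_le0// subrr normr0 mul0r.
have r0 : 0 <= r by rewrite (le_trans _ (xr 0%N 0 _))// lexx.
have L20 : 0 <= 2 * L by rewrite mulr_ge0// ltW.
(* [2 * r] bounds the first difference, and the weight at [T] bounds the weight at all earlier
   times. *)
exists (2 * r * expweight G (2 * L) T) => n t tT.
have [t0|t0] := leP 0 t; last first.
  rewrite !picard_le0 ?(ltW t0)// subrr normr0 mulr_ge0 ?exprn_ge0 ?invr_ge0//.
  by rewrite mulr_ge0 ?expR_ge0// mulr_ge0.
have : forall t, 0 <= t <= T -> `|picard n.+1 t - picard n t| <=
    2 * r * 2^-1 ^+ n * expweight G (2 * L) t.
  elim: n => [|n IH] s sT.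
    rewrite expr0 mulr1 (le_trans (ler_normB _ _))//.
    rewrite (@le_trans _ _ (2 * r))//.
      by have := xr 1%N s sT; have := xr 0%N s sT; lra.
    by rewrite ler_peMr ?mulr_ge0// expweight_ge1//; case/andP: sT.
  rewrite exprSr (mulrA (2 * r)).
  apply: (picard_map_contract L0 gL _ _ (xr n.+1) (xr n)) => //;
    exact: continuous_picard.
move=> /(_ t); rewrite t0 tT => /(_ isT) /le_trans; apply.
rewrite [leRHS]mulrAC ler_wpM2l ?le_expweight//.
by rewrite mulr_ge0 ?mulr_ge0// exprn_ge0// invr_ge0.
Qed.

Definition picard_lim t : R := lim (picard n t @[n --> \oo]).

Lemma cvg_picard t : picard n t @[n --> \oo] --> picard_lim t.
Proof.
have [K pK] := picard_step t.
exact: (geometric_cvg (fun n => pK n t (lexx _))).1.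
Qed.

Lemma picard_unif T : exists K : R, forall n t, t <= T ->
  `|picard_lim t - picard n t| <= K * 2^-1 ^+ n.
Proof.
have [K pK] := picard_step T; exists (K * 2) => n t tT.
exact: (geometric_cvg (fun n => pK n t tT)).2.
Qed.

Lemma geometric_eps (K e : R) : 0 < e -> exists n, K * 2^-1 ^+ n < e.
Proof.
move=> e0; have : K * 2^-1 ^+ n @[n --> \oo] --> (0 : R).
  by apply: cvg_geometric; rewrite ger0_norm ?invf_lt1 ?ltr1n.
move/cvgrPdist_lt => /(_ _ e0)[n _ /(_ n)] /= nK; exists n.
by rewrite (le_lt_trans _ (nK _))// sub0r normrN ler_norm.
Qed.

(** An e/3 argument: convergence is uniform on the times up to [t + 1], which form a neighbourhood
    of [t]. *)
Lemma continuous_picard_lim : continuous picard_lim.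
Proof.
move=> t; apply/cvgrPdist_lt => e e0; have [K pK] := picard_unif (t + 1).
have e3 : 0 < e / 3 by rewrite divr_gt0.
have [n Kn] := geometric_eps K e3.
have /cvgrPdist_lt/(_ _ e3) := @continuous_picard n t.
have : \forall s \near t, s <= t + 1.
  by near=> s; rewrite ltW//; near: s; apply: lt_nbhsl; rewrite ltrDl.
apply: filterS2 => s st ns.
have := pK n t; rewrite lerDl => /(_ ler01) pt; have := pK n s st => ps.
have -> : picard_lim t - picard_lim s = (picard_lim t - picard n t) +
  (picard n t - picard n s) - (picard_lim s - picard n s) by ring.
rewrite (le_lt_trans (ler_normB _ _))//.
have := ler_normD (picard_lim t - picard n t) (picard n t - picard n s); lra.
Unshelve. all: by end_near. Qed.

Lemma picard_lim_bounded T : exists r, forall t, 0 <= t <= T ->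
  `|picard_lim t| <= r /\ forall n, `|picard n t| <= r.
Proof.
have [r xr] := picard_bounded T; exists r => t tT.
split; last by move=> n; exact: xr.
have cp : `|picard n t| @[n --> \oo] --> `|picard_lim t|.
  by apply: cvg_norm; exact: cvg_picard.
rewrite -(cvg_lim _ cp)//; apply: limr_le.
  by apply/cvg_ex; eexists; exact: cp.
by apply: nearW => n; exact: xr.
Qed.

Lemma picard_lim_fixpoint t : picard_map picard_lim t = picard_lim t.
Proof.
have [t0|t0] := leP t 0.
  rewrite picard_map_le0//; apply/esym/cvg_lim => //.
  by under eq_fun do rewrite picard_le0//; exact: cvg_cst.
have [r xr] := picard_lim_bounded t; have [L L0 gL] := g_lip t r.
have [K pK] := picard_unif t.
have L20 : 0 <= 2 * L by rewrite mulr_ge0// ltW.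
pose w := expweight G (2 * L) t.
(* [picard n.+1] is the image of [picard n], so the contraction applies to the distance from
   [picard n] to the limit. *)
have bd n : `|picard_map picard_lim t - picard n.+1 t| <= K / 2 * w * 2^-1 ^+ n.
  rewrite mulrAC (mulrAC K); apply: (picard_map_contract L0 gL).
  - exact: continuous_picard_lim.
  - exact: continuous_picard.
  - by move=> s /xr[].
  - by move=> s /xr[].
  - move=> s /andP[s0 st]; rewrite (le_trans (pK n s st))//.
    rewrite ler_peMr ?expweight_ge1//; exact: le_trans (pK n s st).
  - by rewrite lexx ltW.
(* The two errors add up to (K / 2 * w + K / 2) / 2^n, through the intermediate point
   [picard n.+1 t]. *)
apply/eqP; rewrite -subr_eq0 -normr_le0; apply/ler_addgt0Pl => e e0.
rewrite addr0.
have [n nK] := geometric_eps (K / 2 * w + K / 2) e0.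
have := bd n; have := pK n.+1 t (lexx _); rewrite exprS.
have := ler_distD (picard n.+1 t) (picard_map picard_lim t) (picard_lim t).
rewrite (distrC (picard n.+1 t)).
move: nK; rewrite mulrDl; set q := 2^-1 ^+ n; lra.
Qed.

(** Two fixed points are bounded on [0, t] by a common [r]; applying the contraction n times to
    their difference leaves a factor 1 / 2^n, for every n. *)
Lemma picard_map_unique x y : continuous x -> continuous y ->
  (forall t, 0 <= t -> x t = picard_map x t) ->
  (forall t, 0 <= t -> y t = picard_map y t) ->
  forall t, 0 <= t -> x t = y t.
Proof.
move=> cx cy xE yE t t0.
have [rx xr] := continuous_bounded_itv t cx.
have [ry yr] := continuous_bounded_itv t cy.
pose r := Num.max rx ry; have [L L0 gL] := g_lip t r.
have {}xr s : 0 <= s <= t -> `|x s| <= r.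
  by move=> /xr /le_trans; apply; rewrite le_max lexx.
have {}yr s : 0 <= s <= t -> `|y s| <= r.
  by move=> /yr /le_trans; apply; rewrite le_max lexx orbT.
have r0 : 0 <= r by rewrite (le_trans _ (xr t _))// lexx t0.
have L20 : 0 <= 2 * L by rewrite mulr_ge0// ltW.
have bd n s : 0 <= s <= t ->
    `|x s - y s| <= 2 * r * 2^-1 ^+ n * expweight G (2 * L) s.
  elim: n s => [|n IH] s sT; have s0 : 0 <= s by case/andP: sT.
    rewrite expr0 mulr1 (@le_trans _ _ (2 * r))//; last first.
      by rewrite ler_peMr ?mulr_ge0// expweight_ge1.
    by have := ler_normB (x s) (y s); have := xr s sT; have := yr s sT; lra.
  rewrite (xE s s0) (yE s s0) exprSr (mulrA (2 * r)).
  exact: (picard_map_contract L0 gL).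
apply/eqP; rewrite -subr_eq0 -normr_le0; apply/ler_addgt0Pl => e e0.
rewrite addr0.
have [n nK] := geometric_eps (2 * r * expweight G (2 * L) t) e0.
have := bd n t; rewrite t0 lexx => /(_ isT) /le_trans; apply.
by rewrite mulrAC ltW.
Qed.

End picard.

(** * Variation functions and coefficients *)

Section variations.
Context {R : realType}.
Implicit Types (f x : R -> R).

(** Extending a path by its value at 0 replaces continuity within the half-line by continuity on the
    line, as the Picard section requires. *)
Lemma continuous_max0 f : continuous_path f ->
  continuous (fun t : R => f (Num.max 0 t)).
Proof.
move=> /subspace_continuousP cf t.
have p0 (s : R) : `[0, +oo[%classic (Num.max 0 s).
  by rewrite /= in_itv/= andbT le_max lexx.
have cp : {for t, continuous (fun s : R => Num.max 0 s)}.
  by apply: continuous_max; [exact: cvg_cst|exact: cvg_id].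
have := cf _ (p0 t); apply: cvg_trans => A /= fA.
have : \forall s \near t,
    `[0, +oo[%classic (Num.max 0 s) -> A (f (Num.max 0 s)).
  exact: cp _ fA.
by apply: filterS => s /(_ (p0 s)).
Qed.

Lemma continuous_path_left f t : continuous_path f -> 0 < t ->
  f s @[s --> t^'-] --> f t.
Proof.
move=> cf t0; have -> : f t = f (Num.max 0 t) by rewrite max_r// ltW.
have : f (Num.max 0 s) @[s --> t^'-] --> f (Num.max 0 t).
  exact/cvg_at_left_filter/continuous_max0.
apply: cvg_trans.
apply: near_eq_cvg; near=> s; rewrite max_r//.
by near: s; exact: nbhs_left_ge.
Unshelve. all: by end_near. Qed.

(** Only left continuity remains to be shown. At positive times the function is (TV - f) / 2, and
    the total variation TV inherits left continuity from f. *)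
Lemma neg_variation_continuous f (hf : continuous_fv f) :
  continuous (neg_variation hf).
Proof.
move=> t; apply/left_right_continuousP; split; last first.
  exact: neg_variation_right_continuous.
have [t0|t0] := leP t 0.
  apply: cvg_near_cst; near=> s; have s0 : s <= 0.
    by rewrite (le_trans _ t0)// ltW//; near: s; exact: nbhs_left_lt.
  by rewrite /neg_variation (max_l t0) (max_l s0).
have TVl := total_variation_left_continuous t0 (lexx t)
  (continuous_path_left hf.1 t0) (hf.2 _ _ (lexx 0) (ltW t0)).
have nE s : 0 <= s ->
    neg_variation hf s = (fine (total_variation 0 s f) - f s) * 2^-1.
  move=> s0; rewrite /neg_variation max_r// /neg_tv.
  have /fineK <- : total_variation 0 s f \is a fin_num.
    by apply/bounded_variationP => //; exact: hf.2.
  by rewrite -EFinB -EFinM.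
rewrite nE ?ltW//.
have : (fine (total_variation 0 s f) - f s) * 2^-1 @[s --> t^'-] -->
    (fine (total_variation 0 t f) - f t) * 2^-1.
  apply: cvgM; last exact: cvg_cst.
  by apply: cvgB; [exact: TVl|exact: continuous_path_left hf.1 t0].
apply: cvg_trans; apply: near_eq_cvg; near=> s; rewrite nE//.
by near: s; exact: nbhs_left_ge.
Unshelve. all: by end_near. Qed.

Lemma pos_neg_variation f (hf : continuous_fv f) t : 0 <= t ->
  pos_variation hf t - neg_variation hf t = f t.
Proof.
move=> t0; have /(_ t) := bounded_variation_pos_neg_tvE (hf.2 _ _ (lexx 0) t0).
rewrite in_itv/= t0 lexx => /(_ isT) ->.
by rewrite /pos_variation /neg_variation max_r.
Qed.

End variations.

(** * Growth and Lipschitz bounds for the corrected drift *)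

Section coefficients.
Context {R : realType}.
Implicit Types (g : R -> R -> R).

(** Compact sets are replaced by the boxes [0, T] x [-r, r], so that constants can be combined
    without further compactness arguments. *)
Definition box_lipschitz g := forall T r : R, exists2 L : R, 0 < L &
  forall s t x y : R, 0 <= s <= T -> 0 <= t <= T -> `|x| <= r -> `|y| <= r ->
    `|g s x - g t y| <= L * (`|s - t| + `|x - y|).

Lemma locally_lipschitz_box g : locally_lipschitz g -> box_lipschitz g.
Proof.
move=> gL T r.
have [||L L0 gK] := gL (`[0, T]%classic `*` `[- r, r]%classic).
- by apply: compact_setX; exact: segment_compact.
- move=> [s x] /= [+ _]; rewrite in_itv/= => /andP[s0 _].
  by split => //=; rewrite in_itv/= s0.
exists L => // s t x y sT tT xr yr.
by apply: (gK (s, x) (t, y)); split => /=; rewrite in_itv//= -ler_norml.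
Qed.

Lemma box_lipschitzN g : box_lipschitz g -> box_lipschitz (fun t x => - g t x).
Proof.
move=> gL T r; have [L L0 gK] := gL T r; exists L => // s t x y sT tT xr yr.
by rewrite -opprD normrN gK.
Qed.

Lemma linearly_growingN g :
  linearly_growing g -> linearly_growing (fun t x => - g t x).
Proof. by move=> [C C0 gC]; exists C => // t x t0; rewrite normrN gC. Qed.

Lemma box_lipschitz_snd_continuous g t : 0 <= t -> box_lipschitz g ->
  continuous (g t).
Proof.
move=> t0 gL x; have [L L0 gK] := gL t (`|x| + 1).
apply/cvgrPdist_lt => e e0.
(* The 1 keeps [y] in the box of radius [|x| + 1]. *)
have eL : 0 < Num.min 1 (e / L) by rewrite lt_min ltr01 divr_gt0.
near=> y; have : `|x - y| < Num.min 1 (e / L).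
  by near: y; apply: (@cvgr_dist_lt _ _ _ _ _ id x) => //; exact: cvg_id.
rewrite lt_min ltr_pdivlMr// => /andP[xy1 xyL].
rewrite (le_lt_trans (gK t t x y _ _ _ _)) ?lexx ?t0 ?lerDl//.
  rewrite (_ : y = x - (x - y)); last by rewrite opprB addrC subrK.
  by rewrite (le_trans (ler_normB _ _))// lerD2l ltW.
by rewrite subrr normr0 add0r mulrC.
Unshelve. all: by end_near. Qed.

(** The Lipschitz constant bounds all difference quotients, hence their limit. This is what keeps
    the product of sigma and its space derivative of linear growth. *)
Lemma partial2_bounded g : (forall t x, 0 <= t -> derivable2 g t x) ->
  lipschitz_snd g ->
  exists2 M : R, 0 < M & forall t x, 0 <= t -> `|partial2 g t x| <= M.
Proof.
move=> dg [M M0 gM]; exists M => // t x t0; rewrite /partial2 derive1E.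
have /cvg_norm cd := dg t x t0.
rewrite /derive; set l := lim _ in cd *.
have {}cd : `|h^-1 *: ((g t \o shift x) (h *: (1 : R)) - g t x)|
    @[h --> 0^'] --> `|l| by exact: cd.
rewrite -(cvg_lim _ cd)//; apply: limr_le.
  by apply/cvg_ex; eexists; exact: cd.
near=> h; have h0 : h != 0 by near: h; exact: nbhs_dnbhs_neq.
rewrite normrM normfV ler_pdivrMl ?normr_gt0//= mulrC.
rewrite (le_trans (gM _ _ _ t0))// addrK [h *: 1]mulr1//.
Unshelve. all: by end_near. Qed.

Lemma drift_growth (m s d : R -> R -> R) (M : R) :
  (forall t x, 0 <= t -> `|d t x| <= M) ->
  linearly_growing m -> linearly_growing s ->
  linearly_growing (fun t x => m t x - 2^-1 * s t x * d t x).
Proof.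
move=> dM [C C0 mC] [D D0 sD].
have M0 : 0 <= M by rewrite (le_trans _ (dM 0 0 _)).
exists (C + D * M) => [|t x t0]; first by rewrite ltr_wpDr// mulr_ge0// ltW.
rewrite (le_trans (ler_normB _ _))// mulrDl lerD ?mC//.
rewrite -mulrA normrM (@le_trans _ _ (`|s t x * d t x|))//.
  by rewrite ler_piMl// ger0_norm ?invf_le1 ?ler1n.
by rewrite normrM mulrAC ler_pM ?sD ?dM.
Qed.

Lemma drift_box_lipschitz (m s d : R -> R -> R) (M : R) :
  (forall t x, 0 <= t -> `|d t x| <= M) -> linearly_growing s ->
  box_lipschitz m -> box_lipschitz s -> box_lipschitz d ->
  box_lipschitz (fun t x => m t x - 2^-1 * s t x * d t x).
Proof.
move=> dM [D D0 sD] mL sL dL T r.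
have [L L0 mK] := mL T r; have [K K0 sK] := sL T r; have [N N0 dK] := dL T r.
have M0 : 0 <= M by rewrite (le_trans _ (dM 0 0 _)).
(* A bound for [s] on the box, kept nonnegative because [T] and [r] are arbitrary reals. *)
pose S := Num.max 0 (D * (1 + T + r)).
have S0 : 0 <= S by rewrite le_max lexx.
exists (L + (S * N + M * K)) => [|a b x y aT bT xr yr].
  by rewrite ltr_wpDr// addr_ge0// mulr_ge0// ltW.
have /andP[a0 _] := aT; have /andP[b0 _] := bT.
set e := `|a - b| + `|x - y|; have e0 : 0 <= e by rewrite addr_ge0.
have sS : `|s a x| <= S.
  rewrite le_max; apply/orP; right; rewrite (le_trans (sD _ _ a0))// ler_pM2l//.
  by case/andP: aT => _ aT; rewrite lerD ?lerD2l.
have -> : m a x - 2^-1 * s a x * d a x - (m b y - 2^-1 * s b y * d b y) =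
  (m a x - m b y) - 2^-1 * (s a x * (d a x - d b y) + (s a x - s b y) * d b y).
  by ring.
rewrite (le_trans (ler_normB _ _))// [leRHS]mulrDl lerD ?mK// normrM.
rewrite (@le_trans _ _ `|s a x * (d a x - d b y) + (s a x - s b y) * d b y|)//.
  by rewrite ler_piMl// ger0_norm ?invf_le1 ?ler1n.
rewrite (le_trans (ler_normD _ _))// [leRHS]mulrDl !normrM lerD//.
  by rewrite -mulrA ler_pM ?dK.
by rewrite mulrC -mulrA ler_pM ?dM ?sK.
Qed.

End coefficients.

(** * Switching between finitely many states *)

Section switching.
Context {R : realType} {E : finType}.
Implicit Types (c : E -> R -> R -> R) (j : R -> E).

Lemma finite_uniform_bound (P : E -> R -> Prop) :
  (forall e K L, P e K -> K <= L -> P e L) ->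
  (forall e, exists2 K, 0 < K & P e K) ->
  exists2 K, 0 < K & forall e, P e K.
Proof.
move=> Pmono PE.
have /boolp.choice [K KP] : forall e, exists K, 0 < K /\ P e K.
  by move=> e; have [K ? ?] := PE e; exists K.
(* The sum dominates each [K e]; the added 1 keeps it positive even if [E] is empty. *)
exists (1 + \sum_e K e) => [|e].
  by rewrite ltr_pwDl// sumr_ge0// => e _; rewrite ltW// (KP e).1.
apply: Pmono (KP e).2 _; rewrite (bigD1 e)//= addrCA lerDl addr_ge0//.
by rewrite sumr_ge0// => i _; rewrite ltW// (KP i).1.
Qed.

Lemma linearly_growing_uniform c : (forall e, linearly_growing (c e)) ->
  exists2 C : R, 0 < C &
    forall e (t x : R), 0 <= t -> `|c e t x| <= C * (1 + t + `|x|).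
Proof.
move=> cG; apply: (@finite_uniform_bound (fun e C => forall t x : R, 0 <= t ->
  `|c e t x| <= C * (1 + t + `|x|))) cG => e K L cK KL t x t0.
by rewrite (le_trans (cK t x t0))// ler_wpM2r// !addr_ge0.
Qed.

Lemma box_lipschitz_uniform c : (forall e, box_lipschitz (c e)) ->
  forall T r : R, exists2 L : R, 0 < L & forall e (s t x y : R),
    0 <= s <= T -> 0 <= t <= T -> `|x| <= r -> `|y| <= r ->
    `|c e s x - c e t y| <= L * (`|s - t| + `|x - y|).
Proof.
move=> cL T r; apply: (@finite_uniform_bound (fun e L => forall s t x y : R,
    0 <= s <= T -> 0 <= t <= T -> `|x| <= r -> `|y| <= r ->
    `|c e s x - c e t y| <= L * (`|s - t| + `|x - y|))) =>
  [e K L cK KL s t x y sT tT xr yr|e].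
  by rewrite (le_trans (cK _ _ _ _ sT tT xr yr))// ler_wpM2r// addr_ge0.
exact: cL.
Qed.

(** Just after [s] the state stays equal to [j s], so a single coefficient is seen there, and its
    Lipschitz bound on a box concludes. *)
Lemma switched_coef_rc c j (x : R -> R) (s : R) :
  (forall e, box_lipschitz (c e)) -> cadlag_path j -> continuous x ->
  0 <= s -> c (j u) u (x u) @[u --> s^'+] --> c (j s) s (x s).
Proof.
move=> cL [jr _] cx s0; have [M xM] := continuous_bounded_itv (s + 1) cx.
have [L L0 cK] := cL (j s) (s + 1) M.
apply/cvgrPdist_lt => e e0; have eL : 0 < e / L / 2 by rewrite !divr_gt0.
near=> u.
have su : s <= u by near: u; exact: nbhs_right_ge.
have us : u <= s + 1 by near: u; apply: nbhs_right_le; rewrite ltrDl.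
have -> : j u = j s by near: u; exact: jr.
have sT : 0 <= s <= s + 1 by rewrite s0/= lerDl.
have uT : 0 <= u <= s + 1 by rewrite (le_trans s0).
rewrite (le_lt_trans (cK _ _ _ _ sT uT (xM _ sT) (xM _ uT)))//.
have xsu : `|x s - x u| < e / L / 2.
  near: u; have /cvg_at_right_filter/cvgrPdist_lt := cx s; exact.
have usL : `|s - u| < e / L / 2.
  near: u; have /cvg_at_right_filter/cvgrPdist_lt := @cvg_id _ (nbhs s); exact.
by rewrite mulrC -ltr_pdivlMr// [ltRHS]splitr ltrD.
Unshelve. all: by end_near. Qed.

End switching.

(** * The equation along a path and its measurability *)

Lemma sum_ord3 (V : zmodType) (u : 'I_3 -> V) :
  \sum_i u i = u ord0 + (u (lift ord0 ord0) + u (lift ord0 (lift ord0 ord0))).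
Proof. by rewrite !big_ord_recl big_ord0 addr0. Qed.

Section path.
Context {R : realType} {E : finType} (b sigma : E -> R -> R -> R) (x0 : R).
Context (b_growth : forall e, linearly_growing (b e)).
Context (sigma_growth : forall e, linearly_growing (sigma e)).
Context (b_lip : forall e, box_lipschitz (b e)).
Context (sigma_lip : forall e, box_lipschitz (sigma e)).

(* The integral against the driver is split into those against its two variation
   functions, the negative one being counted with the coefficient [- sigma]. *)
Definition integrators f (hf : continuous_fv f) (i : 'I_3) : cumulative R R :=
  match (i : nat) with
  | 0%N => idfun
  | 1%N => pos_variation hf
  | _ => neg_variation hf
  end.

Definition coef (i : 'I_3) : E -> R -> R -> R :=
  match (i : nat) with
  | 0%N => b
  | 1%N => sigma
  | _ => fun e t x => - sigma e t x
  end.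

Definition path_coef (j : R -> E) (i : 'I_3) (t x : R) := coef i (j t) t x.

Lemma continuous_integrators f (hf : continuous_fv f) i :
  continuous (integrators hf i).
Proof.
case: i => -[|[|k]] ik; rewrite /integrators/=.
- by move=> t; exact: cvg_id.
- exact: neg_variation_continuous.
- exact: neg_variation_continuous.
Qed.

Lemma coef_growing i e : linearly_growing (coef i e).
Proof. by case: i => -[|[|k]] ik //; exact: linearly_growingN. Qed.

Lemma coef_box_lipschitz i e : box_lipschitz (coef i e).
Proof. by case: i => -[|[|k]] ik //; exact: box_lipschitzN. Qed.

Lemma path_coef_rc j i (x : R -> R) : cadlag_path j -> continuous x ->
  forall s, 0 < s ->
    path_coef j i u (x u) @[u --> s^'+] --> path_coef j i s (x s).
Proof.
move=> hj cx s s0.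
apply: (switched_coef_rc (c := coef i)) => //; last exact: ltW.
by move=> e; exact: coef_box_lipschitz.
Qed.

(** Uniformity is taken over pairs of an integrator and a state, so the constant holds whatever
    state [j] occupies. *)
Lemma path_coef_growth j : exists2 C : R, 0 < C &
  forall i (t x : R), 0 <= t -> `|path_coef j i t x| <= C * (1 + t + `|x|).
Proof.
have [|C C0 cC] := @linearly_growing_uniform R _
    (fun p : 'I_3 * E => coef p.1 p.2); first by move=> p; exact: coef_growing.
by exists C => // i t x; exact: (cC (i, j t)).
Qed.

Lemma path_coef_lip j (T r : R) : exists2 L : R, 0 < L &
  forall i (t x y : R), 0 <= t <= T -> `|x| <= r -> `|y| <= r ->
    `|path_coef j i t x - path_coef j i t y| <= L * `|x - y|.
Proof.
have [|L L0 cL] := @box_lipschitz_uniform R _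
    (fun p : 'I_3 * E => coef p.1 p.2) _ T r.
  by move=> p; exact: coef_box_lipschitz.
exists L => // i t x y tT xr yr; have := cL (i, j t) t t x y tT tT xr yr.
by rewrite subrr normr0 add0r.
Qed.

Lemma picard_map_equation j f (hf : continuous_fv f) (x : R -> R) t :
  cadlag_path j -> continuous x -> 0 <= t ->
  picard_map (integrators hf) (path_coef j) x0 x t =
  x0 + \int[lebesgue_measure]_(s in `[0, t]) b (j s) s (x s)
     + stieltjes_integral hf t (fun s => sigma (j s) s (x s)).
Proof.
move=> hj cx t0.
have rc i : rc_locally_bounded (fun s => path_coef j i s (x s)).
  apply: rclb_coef => //; last exact: path_coef_growth.
  by move=> {}i y cy; exact: path_coef_rc.
rewrite /picard_map sum_ord3 -[RHS]addrA; congr (x0 + _).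
congr (_ + _).
  (* The measure of the integrator [idfun] is Lebesgue measure, for which the endpoint 0 is
     negligible. *)
  apply: Rintegral_itv_obnd_cbnd.
  exact: (@rclb_integrable R idfun _ t t0 (rc ord0)).
rewrite /stieltjes_integral; congr (_ + _).
under eq_Rintegral do rewrite /path_coef /coef/= -mulN1r.
rewrite RintegralZl ?mulN1r//.
exact: (rclb_integrable (neg_variation hf) t0 (rc (lift ord0 ord0))).
Qed.

(** The variation functions disappear: only values of the driver itself remain, and these are random
    variables. *)
Lemma riemann_sum_integrators j f (hf : continuous_fv f) (x : R -> R) t n :
  0 <= t ->
  \sum_i riemann_sum (fun s => path_coef j i s (x s)) (integrators hf i)
           t n true
  = \sum_(k < n.+1) (let s := grid t n k.+1 in
      b (j s) s (x s) * (s - grid t n k) +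
      sigma (j s) s (x s) * (f s - f (grid t n k))).
Proof.
move=> t0; rewrite sum_ord3 /riemann_sum -!big_split/=.
apply: eq_bigr => k _; rewrite addn1; congr (_ + _).
rewrite -(pos_neg_variation hf (grid_ge0 n k.+1 t0)).
rewrite -(pos_neg_variation hf (grid_ge0 n k t0)) /path_coef/=.
by rewrite /integrators /coef/=; ring.
Qed.

End path.

(** * Measurability of the iterates in the random parameter *)

Section process.
Context {R : realType} {d : measure_display} {T : measurableType d}.
Context {E : finType}.
Context (b sigma : E -> R -> R -> R) (x0 : R).
Context (b_growth : forall e, linearly_growing (b e)).
Context (sigma_growth : forall e, linearly_growing (sigma e)).
Context (b_lip : forall e, box_lipschitz (b e)).
Context (sigma_lip : forall e, box_lipschitz (sigma e)).
Context (J : R -> T -> E) (F : R -> T -> R).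
Context (hJ : jump_process J) (hF : forall w, continuous_fv (F^~ w)).
Context (mF : forall t, measurable_fun [set: T] (F t)).

(** The random index is removed by summing over the finitely many events on which [J t] is constant;
    each remaining coefficient is continuous in space. *)
Lemma measurable_switched (c : E -> R -> R -> R) t (y : T -> R) : 0 <= t ->
  (forall e, box_lipschitz (c e)) -> measurable_fun [set: T] y ->
  measurable_fun [set: T] (fun w => c (J t w) t (y w)).
Proof.
move=> t0 cL my; have [mJ _ _] := hJ.
rewrite (_ : (fun w => _) =
  (fun w => \sum_e \1_[set v | J t v = e] w * c e t (y w))); last first.
  apply/funext => w; rewrite (bigD1 (J t w))//= big1 => [|e eJ].
    by rewrite addr0 indicE mem_set// mul1r.
  by rewrite indicE memNset ?mul0r//= => Je; rewrite Je eqxx in eJ.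
apply: measurable_sum => e; apply: measurable_funM.
  exact/measurable_indic/mJ.
apply: measurableT_comp my; apply: continuous_measurable_fun.
exact: box_lipschitz_snd_continuous.
Qed.

Let X n t w :=
  picard (integrators (hF w)) (path_coef b sigma (J^~ w)) x0 n t.

Lemma measurable_picard n t : measurable_fun [set: T] (X n t).
Proof.
have [_ cJ _] := hJ.
have cX k w : continuous (fun u => X k u w).
  apply: continuous_picard; first exact: continuous_integrators.
    by move=> i x cx; exact: path_coef_rc.
  exact: path_coef_growth.
elim: n t => [|n IH] t; first exact: measurable_cst.
have [t0|t0] := leP t 0.
  rewrite (_ : X n.+1 t = cst x0); first exact: measurable_cst.
  by apply/funext => w; exact: picard_le0.
(* The next iterate is a pointwise limit of sums that involve [X n] at grid times only, so the
   induction hypothesis is used at many times. *)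
apply: (@measurable_fun_cvg _ _ _ _ (fun m w => x0 + \sum_(k < m.+1)
  (let s := grid t m k.+1 in
      b (J s w) s (X n s w) * (s - grid t m k) +
      sigma (J s w) s (X n s w) * (F s w - F (grid t m k) w)))).
  move=> m; apply: measurable_funD => //; apply: measurable_sum => k /=.
  have s0 : 0 <= grid t m k.+1 by apply: grid_ge0; exact: ltW.
  apply: measurable_funD; apply: measurable_funM => //.
  - exact: measurable_switched.
  - exact: measurable_switched.
  - exact: measurable_funB.
move=> w _; apply: cvgD; first exact: cvg_cst.
rewrite [Z in Z @ _](_ : _ = fun m => \sum_i riemann_sum
    (fun s => path_coef b sigma (J^~ w) i s (X n s w))
    (integrators (hF w) i) t m true); last first.
  by apply/funext => m; rewrite riemann_sum_integrators ?ltW.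
apply: cvg_sumr => i; apply: rclb_cvg; first exact: ltW.
apply: rclb_coef => //; last exact: path_coef_growth.
by move=> {}i x cx; exact: path_coef_rc.
Qed.

End process.

Unset Implicit Arguments.

Theorem proposition4p1 (R : realType) (d : measure_display)
    (T : measurableType d) (P : probability T R) (E : finType)
    (J : R -> T -> E) (F : R -> {RV P >-> R}) (x0 : R)
    (mu sigma : E -> R -> R -> R)
    (hJ : jump_process J)
    (hF : forall w : T, continuous_fv (fun t => F t w))
    (hmu : forall i : E,
      [/\ continuous_coef (mu i), linearly_growing (mu i) &
          locally_lipschitz (mu i)])
    (hsigma : forall i : E,
      [/\ class_C11 (sigma i), linearly_growing (sigma i),
          locally_lipschitz (sigma i) & lipschitz_snd (sigma i)])
    (hdsigma : forall i : E,
      locally_lipschitz (partial1 (sigma i)) /\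
      locally_lipschitz (partial2 (sigma i))) :
  exists X : R -> {RV P >-> R},
    (forall w : T,
      pathwise_solution mu sigma x0 (fun t => J t w) (hF w)
        (fun t => X t w)) /\
    (forall Y : R -> {RV P >-> R}, forall w : T,
      pathwise_solution mu sigma x0 (fun t => J t w) (hF w)
        (fun t => Y t w) ->
      forall t : R, 0 <= t -> Y t w = X t w).
Proof.
(* The correction term is absorbed into the drift, which remains of linear growth but is only
   locally Lipschitz. *)
pose b e t x := mu e t x - 2^-1 * sigma e t x * partial2 (sigma e) t x.
have sG e : linearly_growing (sigma e) by have [] := hsigma e.
have sL e : box_lipschitz (sigma e).
  by have [_ _ /locally_lipschitz_box] := hsigma e.
have dB e : exists2 M : R, 0 < M &
    forall t x, 0 <= t -> `|partial2 (sigma e) t x| <= M.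
  by have [[_ _ ? _ _] _ _ ?] := hsigma e; exact: partial2_bounded.
have bG e : linearly_growing (b e).
  have [M _ dM] := dB e; apply: (drift_growth dM) => //.
  by have [] := hmu e.
have bL e : box_lipschitz (b e).
  have [M _ dM] := dB e; apply: (drift_box_lipschitz dM) => //.
    by have [_ _ /locally_lipschitz_box] := hmu e.
  exact/locally_lipschitz_box/(hdsigma e).2.
have [_ cJ _] := hJ.
pose G w := integrators (hF w); pose g w := path_coef b sigma (J^~ w).
have cG w i : continuous (G w i) by exact: continuous_integrators.
have g_rc w i (x : R -> R) : continuous x ->
    forall s, 0 < s -> g w i u (x u) @[u --> s^'+] --> g w i s (x s).
  by move=> cx; exact: path_coef_rc.
have gG w := path_coef_growth bG sG (J^~ w).
have gL w := path_coef_lip bL sL (J^~ w).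
pose X t w := picard_lim (G w) (g w) x0 t.
have mX t : measurable_fun [set: T] (X t).
  apply: (@measurable_fun_cvg _ _ _ _ (fun n w => picard (G w) (g w) x0 n t)).
    by move=> n; apply: measurable_picard => //.
  by move=> w _; exact: (cvg_picard (cG w) (g_rc w) (gG w) (gL w)).
have cX w : continuous (fun t => X t w).
  exact: (continuous_picard_lim (cG w) (g_rc w) (gG w) (gL w)).
have XE w t : picard_map (G w) (g w) x0 (fun t => X t w) t = X t w.
  exact: (picard_lim_fixpoint x0 (cG w) (g_rc w) (gG w) (gL w) t).
have mapE w (x : R -> R) t : continuous x -> 0 <= t ->
    picard_map (G w) (g w) x0 x t =
    x0 + \int[lebesgue_measure]_(s in `[0, t]) b (J s w) s (x s)
     + stieltjes_integral (hF w) t (fun s => sigma (J s w) s (x s)).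
  move=> cx t0.
  exact: (picard_map_equation x0 bG sG bL sL (hF w) (cJ w) cx t0).
exists (fun t => mfun_Sub (mem_set (mX t))); split => [w|Y w [cY Y0 YE] t t0].
  split => [||t t0].
  - exact: (continuous_subspaceT (cX w)).
  - by rewrite /= -[LHS]XE picard_map_le0.
  - by rewrite /= -[LHS]XE mapE.
(* Uniqueness is applied to the extension of [Y] by its value at 0; the integrals only see
   nonnegative times, where nothing changes. *)
have cY0 := continuous_max0 cY.
have YY s : 0 <= s -> Y (Num.max 0 s) w = Y s w by move=> s0; rewrite max_r.
rewrite -(YY t t0).
apply: (picard_map_unique (x0 := x0) (cG w) (g_rc w) (gG w) (gL w)
  cY0 (cX w) _ _ t0).
  move=> s s0; rewrite YY// YE// mapE// /stieltjes_integral.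
  have YYin (A : set R) (c : E -> R -> R -> R) : A `<=` `[0, +oo[ ->
      {in A, (fun u => c (J u w) u (Y u w)) =1
             fun u => c (J u w) u (Y (Num.max 0 u) w)}.
    by move=> A0 u /set_mem/A0/=; rewrite in_itv/= andbT => /YY ->.
  apply: (f_equal2 +%R).
    apply: (f_equal (+%R x0)); apply: eq_Rintegral; apply: (YYin _ b) => u/=.
    by rewrite !in_itv/= andbT => /andP[].
  by apply: (f_equal2 (fun p q => p - q));
    apply: eq_Rintegral; apply: (YYin _ sigma) => u/=;
    rewrite !in_itv/= andbT => /andP[/ltW].
by move=> s _; rewrite XE.
Qed.
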